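(* Let $(A,\nu,\alpha)$ be a regular Hom-pre-Lie algebra over a field $\mathbb{K}$ of characteristic zero and let $(\nu_t,\alpha_t)$, $\nu_t=\sum_{i\ge0}\nu_it^i$, $\alpha_t=\sum_{i\ge0}\alpha_it^i$, be a one-parameter formal deformation of $A$. Then its infinitesimal $(\nu_1,\alpha_1)$ is a $2$-cocycle of the $\alpha$-type cohomology of $A$, i.e. $\widetilde\partial(\nu_1,\alpha_1)=0$.
   Context: $\mathbb{K}$ is a field of characteristic zero. A Hom-pre-Lie algebra $(A,\nu,\alpha)$, $\nu(a,b)=a\cdot b$, is a $\mathbb{K}$-vector space $A$ with a bilinear product $\cdot$ and a linear map $\alpha:A\to A$ such that for all $a,b,c\in A$: $(a\cdot b)\cdot\alpha(c)-\alpha(a)\cdot(b\cdot c)=(b\cdot a)\cdot\alpha(c)-\alpha(b)\cdot(a\cdot c)$ and $\alpha(a\cdot b)=\alpha(a)\cdot\alpha(b)$. It is regular if $\alpha$ is invertible (standing assumption). A one-parameter formal deformation of $A$ is a pair $(\nu_t,\alpha_t)$ of a $\mathbb{K}[[t]]$-bilinear map $\nu_t=\sum_{i\ge0}\nu_it^i:A[[t]]\times A[[t]]\to A[[t]]$ and a $\mathbb{K}[[t]]$-linear map $\alpha_t=\sum_{i\ge0}\alpha_it^i:A[[t]]\to A[[t]]$, where each $\nu_i:A\times A\to A$ is $\mathbb{K}$-bilinear and each $\alpha_i:A\to A$ is $\mathbb{K}$-linear, $\nu_0=\nu$, $\alpha_0=\alpha$, and for all $a,b,c\in A$: $\nu_t(\nu_t(a,b),\alpha_t(c))-\nu_t(\alpha_t(a),\nu_t(b,c))=\nu_t(\nu_t(b,a),\alpha_t(c))-\nu_t(\alpha_t(b),\nu_t(a,c))$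 and $\nu_t(\alpha_t(a),\alpha_t(b))=\alpha_t(\nu_t(a,b))$. Its infinitesimal is the pair $(\nu_1,\alpha_1)$. $\alpha$-type cohomology of $A$ with coefficients in itself, in low degree: $\widetilde C^2(A,A)=\mathrm{Hom}(A^{\otimes2},A)\oplus\mathrm{Hom}(A,A)$, $\widetilde C^3(A,A)=\mathrm{Hom}(A^{\otimes3},A)\oplus\mathrm{Hom}(A^{\otimes2},A)$, and $\widetilde\partial:\widetilde C^2(A,A)\to\widetilde C^3(A,A)$ is $\widetilde\partial(\varphi,\psi)=(\widetilde\partial_{\nu\nu}\varphi-\widetilde\partial_{\alpha\nu}\psi,\ \widetilde\partial_{\nu\alpha}\varphi-\widetilde\partial_{\alpha\alpha}\psi)$, where $(\widetilde\partial_{\nu\nu}\varphi)(a,b,c)=\alpha(a)\cdot\varphi(b,c)-\alpha(b)\cdot\varphi(a,c)+\varphi(b,a)\cdot\alpha(c)-\varphi(a,b)\cdot\alpha(c)-\varphi(\alpha(b),a\cdot c)+\varphi(\alpha(a),b\cdot c)-\varphi(a\cdot b,\alpha(c))+\varphi(b\cdot a,\alpha(c))$; $(\widetilde\partial_{\alpha\nu}\psi)(a,b,c)=\psi(b)\cdot(a\cdot c)-\psi(a)\cdot(b\cdot c)+(a\cdot b)\cdot\psi(c)-(b\cdot a)\cdot\psi(c)$; $(\widetilde\partial_{\nu\alpha}\varphi)(a,b)=\alpha(\varphi(a,b))-\varphi(\alpha(a),\alpha(b))$; $(\widetilde\partial_{\alpha\alpha}\psi)(a,b)=\alpha(a)\cdot\psi(b)+\psi(a)\cdot\alpha(b)-\psi(a\cdot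 b)$. A $2$-cocycle is an element of $\widetilde C^2(A,A)$ killed by $\widetilde\partial$. *)

(* Defs.v *)
From HB Require Import structures.
From mathcomp Require Import all_boot all_algebra.
From mathcomp Require Import boolp functions.

Set Implicit Arguments.
Unset Strict Implicit.
Unset Printing Implicit Defensive.

Import GRing.Theory.
Local Open Scope ring_scope.

(* Formal power series, as coefficient sequences: x n is the coefficient of
   t^n in x.  [fps] is a fresh name for the function type, so that [fps R]
   carries the Cauchy product and not the pointwise product of functions. *)
Definition fps (M : Type) : Type := nat -> M.

HB.instance Definition _ (M : zmodType) :=
  GRing.Zmodule.copy (fps M) (nat -> M).

Definition fpsC (M : zmodType) (a : M) : fps M :=
  fun n => if n is 0%N then a else 0.

Lemma fpsP (M : Type) (x y : fps M) : (forall n, x n = y n) -> x = y.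
Proof. by move=> xy; apply/funext. Qed.

Lemma fpsDE (M : zmodType) (x y : fps M) n : (x + y) n = x n + y n.
Proof. by []. Qed.

Section TriangularSums.
Variable V : nmodType.

Lemma sum_triangle (F : nat -> nat -> V) n :
  \sum_(i < n.+1) \sum_(j < (n - i).+1) F i j =
  \sum_(k < n.+1) \sum_(i < k.+1) F i (k - i)%N.
Proof.
elim: n => [|n IHn]; first by rewrite !big_ord1.
rewrite big_ord_recr [RHS]big_ord_recr /= -IHn subnn big_ord1.
rewrite [X in _ = _ + X]big_ord_recr /= subnn addrA; congr (_ + _).
rewrite -big_split /=; apply: eq_bigr => i _.
by rewrite subSn ?big_ord_recr//= -ltnS ltn_ord.
Qed.

Lemma sum_triangleC (F : nat -> nat -> V) n :
  \sum_(i < n.+1) \sum_(j < (n - i).+1) F i j =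
  \sum_(j < n.+1) \sum_(i < (n - j).+1) F i j.
Proof.
rewrite sum_triangle (sum_triangle (fun j i => F i j)).
apply: eq_bigr => k _; rewrite (reindex_inj rev_ord_inj) /=.
by apply: eq_bigr => i _; rewrite subSS subKn// -ltnS ltn_ord.
Qed.

End TriangularSums.

Section PowerSeriesRing.
Variable R : comNzRingType.
Implicit Types f g h : fps R.

Definition fps_mul f g : fps R := fun n => \sum_(i < n.+1) f i * g (n - i)%N.

Let fps_mulA : associative fps_mul.
Proof.
move=> f g h; apply: fpsP => n; rewrite /fps_mul.
under eq_bigr do rewrite big_distrr /=.
rewrite (sum_triangle (fun i j => f i * (g j * h (n - i - j)%N))).
apply: eq_bigr => k _; rewrite big_distrl /=; apply: eq_bigr => i _.
by rewrite mulrA -subnDA subnKC// -ltnS ltn_ord.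
Qed.

Let fps_mulC : commutative fps_mul.
Proof.
move=> f g; apply: fpsP => n; rewrite /fps_mul (reindex_inj rev_ord_inj) /=.
by apply: eq_bigr => i _; rewrite mulrC subSS subKn// -ltnS ltn_ord.
Qed.

Let fps_mul1 : left_id (fpsC 1) fps_mul.
Proof.
move=> f; apply: fpsP => n; rewrite /fps_mul big_ord_recl /= mul1r subn0.
by rewrite big1 ?addr0// => i _; rewrite mul0r.
Qed.

Let fps_mulDl : left_distributive fps_mul +%R.
Proof.
move=> f g h; apply: fpsP => n; rewrite fpsDE -big_split /=.
by apply: eq_bigr => i _; rewrite mulrDl.
Qed.

Let fps_oner_neq0 : fpsC (1 : R) != 0.
Proof.
by apply/eqP => /(congr1 (fun f : fps R => f 0%N)) /eqP; rewrite (negPf (oner_neq0 _)).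
Qed.

HB.instance Definition _ := GRing.Zmodule_isComNzRing.Build (fps R)
  fps_mulA fps_mulC fps_mul1 fps_mulDl fps_oner_neq0.

End PowerSeriesRing.

Section PowerSeriesModule.
Variables (R : comNzRingType) (M : lmodType R).

Definition fps_scale (f : fps R) (x : fps M) : fps M :=
  fun n => \sum_(i < n.+1) f i *: x (n - i)%N.

Let fps_scaleA f g x : fps_scale f (fps_scale g x) = fps_scale (f * g) x.
Proof.
apply: fpsP => n; rewrite /fps_scale.
under eq_bigr do rewrite scaler_sumr /=.
rewrite (sum_triangle (fun i j => f i *: (g j *: x (n - i - j)%N))).
apply: eq_bigr => k _; rewrite scaler_suml /=; apply: eq_bigr => i _.
by rewrite scalerA -subnDA subnKC// -ltnS ltn_ord.
Qed.

Let fps_scale1 : left_id 1 fps_scale.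
Proof.
move=> x; apply: fpsP => n; rewrite /fps_scale big_ord_recl /= scale1r subn0.
by rewrite big1 ?addr0// => i _; rewrite scale0r.
Qed.

Let fps_scaleDr : right_distributive fps_scale +%R.
Proof.
move=> f x y; apply: fpsP => n; rewrite fpsDE -big_split /=.
by apply: eq_bigr => i _; rewrite scalerDr.
Qed.

Let fps_scaleDl x : {morph fps_scale^~ x : f g / f + g}.
Proof.
move=> f g; apply: fpsP => n; rewrite fpsDE -big_split /=.
by apply: eq_bigr => i _; rewrite scalerDl.
Qed.

HB.instance Definition _ := GRing.Zmodule_isLmodule.Build (fps R) (fps M)
  fps_scaleA fps_scale1 fps_scaleDr fps_scaleDl.

Lemma fpsZE (f : fps R) (x : fps M) n :
  (f *: x) n = \sum_(i < n.+1) f i *: x (n - i)%N.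
Proof. by []. Qed.

End PowerSeriesModule.

(* The map sum_i alpha_i t^i on A[[t]]. *)
Section LinearSeries.
Variables (K : comNzRingType) (A : lmodType K).
Variable alpha_ : nat -> {linear A -> A}.

Definition fps_lin (x : fps A) : fps A :=
  fun n => \sum_(i < n.+1) alpha_ i (x (n - i)%N).

Lemma fps_lin_is_linear : linear fps_lin.
Proof.
move=> f x y; apply: fpsP => n; rewrite fpsDE fpsZE /fps_lin.
under eq_bigr do rewrite fpsDE linearD fpsZE linear_sum.
rewrite big_split /=; congr (_ + _).
rewrite (sum_triangleC (fun i j => alpha_ i (f j *: x (n - i - j)%N))).
apply: eq_bigr => j _; rewrite scaler_sumr; apply: eq_bigr => i _.
by rewrite linearZ /= subnAC.
Qed.

HB.instance Definition _ :=
  GRing.isLinear.Build (fps K) (fps A) (fps A) *:%R fps_lin fps_lin_is_linear.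

End LinearSeries.

(* The map sum_i nu_i t^i on A[[t]] x A[[t]]: the coefficient of t^n is the
   sum of nu_i (x_j, y_k) over i + j + k = n. *)
Section BilinearSeries.
Variables (K : comNzRingType) (A : lmodType K).
Variable nu_ : nat -> {bilinear A -> A -> A}.

Definition fps_bil (x y : fps A) : fps A :=
  fun n => \sum_(i < n.+1) \sum_(j < (n - i).+1) nu_ i (x j) (y (n - i - j)%N).

Lemma fps_bil_is_bilinear : bilinear_for *:%R *:%R fps_bil.
Proof.
split=> [y f x x'|x f y y']; apply: fpsP => n; rewrite fpsDE;
  rewrite [in RHS]/= fpsZE /fps_bil.
- under eq_bigr do under eq_bigr do rewrite fpsDE linearDl fpsZE linear_sumlz.
  under eq_bigr do rewrite big_split.
  rewrite big_split /=; congr (_ + _).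
  pose G i l p := nu_ i (f l *: x p) (y (n - i - l - p)%N).
  transitivity (\sum_(i < n.+1) \sum_(l < (n - i).+1)
      \sum_(p < (n - i - l).+1) G i l p).
    apply: eq_bigr => i _; rewrite (sum_triangle (G i)).
    apply: eq_bigr => j _; apply: eq_bigr => l _.
    by rewrite /G -(subnDA l) subnKC// -ltnS ltn_ord.
  rewrite (sum_triangleC (fun i l => \sum_(p < (n - i - l).+1) G i l p)).
  apply: eq_bigr => l _; rewrite scaler_sumr; apply: eq_bigr => i _.
  rewrite scaler_sumr subnAC; apply: eq_bigr => p _.
  rewrite /G linearZl_LR.
  by have -> : (n - i - l - p)%N = (n - l - i - p)%N by rewrite (subnAC n).
- under eq_bigr do under eq_bigr do rewrite fpsDE linearDr fpsZE linear_sumr.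
  under eq_bigr do rewrite big_split.
  rewrite big_split /=; congr (_ + _).
  pose G i l p := nu_ i (x p) (f l *: y (n - i - p - l)%N).
  transitivity (\sum_(i < n.+1) \sum_(l < (n - i).+1)
      \sum_(p < (n - i - l).+1) G i l p).
    by apply: eq_bigr => i _; rewrite (sum_triangleC (G i)).
  rewrite (sum_triangleC (fun i l => \sum_(p < (n - i - l).+1) G i l p)).
  apply: eq_bigr => l _; rewrite scaler_sumr; apply: eq_bigr => i _.
  rewrite scaler_sumr subnAC; apply: eq_bigr => p _.
  rewrite /G linearZr_LR.
  have -> // : (n - i - p - l)%N = (n - l - i - p)%N.
  by rewrite (subnAC _ p) (subnAC n).
Qed.

HB.instance Definition _ := bilinear_isBilinear.Build (fps K)
  (fps A) (fps A) (fps A) *:%R *:%R fps_bil fps_bil_is_bilinear.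

End BilinearSeries.

(* Both sides of the (Hom-)pre-Lie identity have the form
   mu (mu a b) (beta c) - mu (beta a) (mu b c); stated once, it serves for the
   algebra A and for its deformations on A[[t]]. *)
Definition hom_associator (V : zmodType) (mu : V -> V -> V) (beta : V -> V)
  (a b c : V) : V := mu (mu a b) (beta c) - mu (beta a) (mu b c).

Record homPreLie (K : fieldType) (A : lmodType K) := HomPreLie {
  nu : {bilinear A -> A -> A};
  alpha : {linear A -> A};
  homPreLieP : forall a b c : A,
    hom_associator nu alpha a b c = hom_associator nu alpha b a c;
  alphaM : forall a b : A, alpha (nu a b) = nu (alpha a) (alpha b)
}.

Definition regular (K : fieldType) (A : lmodType K) (H : homPreLie A) : Prop :=
  bijective (alpha H).

Record deformation (K : fieldType) (A : lmodType K) (H : homPreLie A) :=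
  Deformation {
  nu_ : nat -> {bilinear A -> A -> A};
  alpha_ : nat -> {linear A -> A};
  nu_0 : forall a b : A, nu_ 0%N a b = nu H a b;
  alpha_0 : forall a : A, alpha_ 0%N a = alpha H a;
  nu_t : {bilinear fps A -> fps A -> fps A} := fps_bil nu_;
  alpha_t : {linear fps A -> fps A} := fps_lin alpha_;
  deformation_preLie : forall a b c : A,
    hom_associator nu_t alpha_t (fpsC a) (fpsC b) (fpsC c) =
    hom_associator nu_t alpha_t (fpsC b) (fpsC a) (fpsC c);
  deformation_mult : forall a b : A,
    nu_t (alpha_t (fpsC a)) (alpha_t (fpsC b)) = alpha_t (nu_t (fpsC a) (fpsC b))
}.

Section Cohomology.
Variables (K : fieldType) (A : lmodType K) (H : homPreLie A).
Local Notation alpha := (alpha H).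
Local Notation "a · b" := (nu H a b) (at level 40, left associativity).

Definition cochain2 : Type := ({bilinear A -> A -> A} * {linear A -> A})%type.

Definition trilinear (f : A -> A -> A -> A) : Prop :=
  [/\ forall b c, linear (fun a => f a b c),
      forall a c, linear (fun b => f a b c)
    & forall a b, linear (fun c => f a b c)].

Definition d_nunu (phi : {bilinear A -> A -> A}) (a b c : A) : A :=
  alpha a · phi b c - alpha b · phi a c + phi b a · alpha c - phi a b · alpha c
  - phi (alpha b) (a · c) + phi (alpha a) (b · c)
  - phi (a · b) (alpha c) + phi (b · a) (alpha c).

Definition d_alphanu (psi : {linear A -> A}) (a b c : A) : A :=
  psi b · (a · c) - psi a · (b · c) + (a · b) · psi c - (b · a) · psi c.

Definition d_nualpha (phi : {bilinear A -> A -> A}) (a b : A) : A :=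
  alpha (phi a b) - phi (alpha a) (alpha b).

Definition d_alphaalpha (psi : {linear A -> A}) (a b : A) : A :=
  alpha a · psi b + psi a · alpha b - psi (a · b).

(* The 3-cochains are the pairs of a trilinear and a bilinear map (lemma
   [dtildeP]); they form a subgroup of the pairs of functions, whose zero is
   the zero cochain. *)
Definition dtilde (x : cochain2) : (A -> A -> A -> A) * (A -> A -> A) :=
  (d_nunu x.1 - d_alphanu x.2, d_nualpha x.1 - d_alphaalpha x.2).

Definition cocycle2 (x : cochain2) : Prop := dtilde x = 0.

Let lin_add (f g : A -> A) : linear f -> linear g -> linear (fun a => f a + g a).
Proof. by move=> lf lg k u v; rewrite lf lg scalerDr addrACA. Qed.

Let lin_opp (f : A -> A) : linear f -> linear (fun a => - f a).
Proof. by move=> lf k u v; rewrite lf scalerN opprD. Qed.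

Lemma dtildeP (x : cochain2) :
  trilinear (dtilde x).1 /\ bilinear_for *:%R *:%R (dtilde x).2.
Proof.
case: x => phi psi; split; [split=> y z | split=> y];
  rewrite /dtilde /= ?/d_nunu ?/d_alphanu ?/d_nualpha ?/d_alphaalpha;
  do ![apply: lin_add || apply: lin_opp]; move=> k u v /=;
  by rewrite ?(linearPl, linearPr, linearP) /= ?(linearPl, linearPr, linearP).
Qed.

End Cohomology.

Definition infinitesimal (K : fieldType) (A : lmodType K) (H : homPreLie A)
  (D : deformation H) : cochain2 A := (nu_ D 1%N, alpha_ D 1%N).

(* Main.v *)
Require Import Defs.
From HB Require Import structures.
From mathcomp Require Import all_boot all_algebra.
From mathcomp Require Import boolp.
Set Implicit Arguments.
Unset Strict Implicit.
Unset Printing Implicit Defensive.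
Import GRing.Theory.
Local Open Scope ring_scope.

(** A deformation satisfies the Hom-pre-Lie and multiplicativity identities as
    identities of power series, so their coefficients of t agree.  Modulo t^2,
    taking the coefficient of t is differentiating at t = 0, so it obeys a
    Leibniz rule: each of the structure maps occurring in a product of series is
    replaced in turn by its first-order term ([fps_bil_coef1],
    [fps_lin_coef1]).  Applied to the Hom-associator and to the two sides of
    multiplicativity, this linearizes the identities at (nu, alpha) in the
    direction (nu_1, alpha_1); up to sign and order of the terms, the two
    linearized identities are the two components of the cocycle condition. *)

Section LowCoefficients.
Variables (K : comNzRingType) (A : lmodType K).
Variables (alpha_ : nat -> {linear A -> A}) (nu_ : nat -> {bilinear A -> A -> A}).
Implicit Types x y : fps A.

Lemma fps_lin_coef0 x : fps_lin alpha_ x 0%N = alpha_ 0%N (x 0%N).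
Proof. by rewrite /fps_lin big_ord1. Qed.

Lemma fps_lin_coef1 x :
  fps_lin alpha_ x 1%N = alpha_ 0%N (x 1%N) + alpha_ 1%N (x 0%N).
Proof. by rewrite /fps_lin !big_ord_recl big_ord0 addr0. Qed.

Lemma fps_bil_coef0 x y : fps_bil nu_ x y 0%N = nu_ 0%N (x 0%N) (y 0%N).
Proof. by rewrite /fps_bil !big_ord1. Qed.

Lemma fps_bil_coef1 x y : fps_bil nu_ x y 1%N =
  nu_ 0%N (x 0%N) (y 1%N) + nu_ 0%N (x 1%N) (y 0%N) + nu_ 1%N (x 0%N) (y 0%N).
Proof. by rewrite /fps_bil !(big_ord_recl, big_ord0) !addr0. Qed.

(** On constant series only the first-order term of the map survives. *)
Lemma fps_lin_fpsC_coef1 a : fps_lin alpha_ (fpsC a) 1%N = alpha_ 1%N a.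
Proof. by rewrite fps_lin_coef1 /= raddf0 add0r. Qed.

Lemma fps_bil_fpsC_coef1 a b :
  fps_bil nu_ (fpsC a) (fpsC b) 1%N = nu_ 1%N a b.
Proof. by rewrite fps_bil_coef1 /= linear0r linear0l !add0r. Qed.

(** The rules for constant series come first, so that they are preferred to the
    general Leibniz rules wherever both apply. *)
Definition low_coefE := (fps_lin_fpsC_coef1, fps_bil_fpsC_coef1,
  fps_lin_coef0, fps_bil_coef0, fps_lin_coef1, fps_bil_coef1).

Lemma hom_associator_coef1 a b c :
  hom_associator (fps_bil nu_) (fps_lin alpha_)
    (fpsC a) (fpsC b) (fpsC c) 1%N =
  (nu_ 0%N (nu_ 0%N a b) (alpha_ 1%N c) + nu_ 0%N (nu_ 1%N a b) (alpha_ 0%N c)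
     + nu_ 1%N (nu_ 0%N a b) (alpha_ 0%N c))
  - (nu_ 0%N (alpha_ 0%N a) (nu_ 1%N b c) + nu_ 0%N (alpha_ 1%N a) (nu_ 0%N b c)
     + nu_ 1%N (alpha_ 0%N a) (nu_ 0%N b c)).
Proof.
have fpsBE x y : (x - y : fps A) 1%N = x 1%N - y 1%N by [].
by rewrite /hom_associator fpsBE !low_coefE.
Qed.

Lemma fps_bil_lin_coef1 a b :
  fps_bil nu_ (fps_lin alpha_ (fpsC a)) (fps_lin alpha_ (fpsC b)) 1%N =
  nu_ 0%N (alpha_ 0%N a) (alpha_ 1%N b) + nu_ 0%N (alpha_ 1%N a) (alpha_ 0%N b)
  + nu_ 1%N (alpha_ 0%N a) (alpha_ 0%N b).
Proof. by rewrite !low_coefE. Qed.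

Lemma fps_lin_bil_coef1 a b :
  fps_lin alpha_ (fps_bil nu_ (fpsC a) (fpsC b)) 1%N =
  alpha_ 0%N (nu_ 1%N a b) + alpha_ 1%N (nu_ 0%N a b).
Proof. by rewrite !low_coefE. Qed.

End LowCoefficients.

Section Infinitesimal.
Variables (K : fieldType) (A : lmodType K) (H : homPreLie A).
Variable D : deformation H.

(** The left-hand side is the coefficient of t in the Hom-associator of
    (b, a, c) minus the one in that of (a, b, c), with its twelve terms
    permuted. *)
Lemma infinitesimal_preLie a b c :
  d_nunu H (nu_ D 1%N) a b c - d_alphanu H (alpha_ D 1%N) a b c = 0.
Proof.
have /(congr1 (fun x : fps A => x 1%N)) := deformation_preLie D a b c.
rewrite !hom_associator_coef1 !nu_0 !alpha_0 => /esym/eqP.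
rewrite -subr_eq0 => /eqP <-.
rewrite /d_nunu /d_alphanu !opprD !opprK !addrA.
by rewrite [LHS](ACl (12*3*8*2*9*5*11*4*7*1*10*6)).
Qed.

(** The left-hand side is the coefficient of t in alpha_t (nu_t (a, b)) minus
    the one in nu_t (alpha_t a, alpha_t b), with its five terms permuted. *)
Lemma infinitesimal_mult a b :
  d_nualpha H (nu_ D 1%N) a b - d_alphaalpha H (alpha_ D 1%N) a b = 0.
Proof.
have /= /(congr1 (fun x : fps A => x 1%N)) := deformation_mult D a b.
rewrite fps_bil_lin_coef1 fps_lin_bil_coef1 !nu_0 !alpha_0 => /esym/eqP.
rewrite -subr_eq0 => /eqP <-.
rewrite /d_nualpha /d_alphaalpha !opprD !opprK !addrA.
by rewrite [LHS](ACl (1*5*3*4*2)).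
Qed.

End Infinitesimal.

Theorem theorem3p3 (K : fieldType) (charK : [pchar K] =i pred0)
    (A : lmodType K) (H : homPreLie A) (regH : regular H)
    (D : deformation H) :
  cocycle2 H (infinitesimal D).
Proof.
rewrite /cocycle2 /dtilde /=; congr pair.
  apply/funext => a; apply/funext => b; apply/funext => c.
  exact: infinitesimal_preLie.
by apply/funext => a; apply/funext => b; exact: infinitesimal_mult.
Qed.
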